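(* Let $p$ be a prime and let $G$ and $K$ be finite noncyclic $p$-groups. Suppose $H_1, \ldots, H_q$ is a minimal powerful cover of $K$ (that is, a powerful cover of $K$ with $q=\sigma_P(K)$ members). If there exists a surjective homomorphism $\alpha: G \rightarrow K$ such that $\alpha^{-1}(H_i)$ is powerful for each $i = 1, \ldots, q$, then $\sigma_P(G) \leq \sigma_P(K)$.
   Context: For a group $G$ and a positive integer $k$, $G^k$ denotes the subgroup generated by $\{g^k \mid g\in G\}$, and $[G,G]$ is the commutator subgroup. A finite $p$-group $G$ ($p$ prime) is called powerful if either $p$ is odd and $[G,G]\subseteq G^p$, or $p=2$ and $[G,G]\subseteq G^4$. A cover of a group $G$ is a collection of proper subgroups of $G$ whose union is $G$. A powerful cover of a finite $p$-group $G$ is a cover of $G$ all of whose members are powerful groups. The powerful covering number $\sigma_P(G)$ of a finite noncyclic $p$-group $G$ is the smallest number of subgroups in a powerful cover of $G$. *)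

(* Defs.v *)
From mathcomp Require Import all_boot all_fingroup all_solvable.

Set Implicit Arguments.
Unset Strict Implicit.
Unset Printing Implicit Defensive.

Local Open Scope group_scope.

Section PowerfulCovers.

Variable gT : finGroupType.
Implicit Types (A : {set gT}) (G H : {group gT}) (C : {set {group gT}}).

Definition power_subgroup (k : nat) A : {set gT} := <<[set g ^+ k | g in A]>>.

Definition powerful (p : nat) A : bool :=
  p.-group A &&
  ((odd p && ([~: A, A] \subset power_subgroup p A))
   || ((p == 2) && ([~: A, A] \subset power_subgroup 4 A))).

Definition group_cover G C : bool :=
  [forall H in C, H \proper G] && (\bigcup_(H in C) (H : {set gT}) == G).

Definition powerful_cover (p : nat) G C : bool :=
  group_cover G C && [forall H in C, powerful p H].

Definition cyclic_subgroups G : {set {group gT}} := [set <[x]>%G | x in G].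

(* The starting point of the arg min is irrelevant as soon as G has a powerful
   cover; it is the value returned otherwise, for instance when G is cyclic, where the
   covering number is a junk value. *)
Definition powerful_covering_number (p : nat) G : nat :=
  #|[arg min_(C < cyclic_subgroups G | powerful_cover p G C) #|C|]|.

Lemma cyclic_powerful p G :
  prime p -> p.-group G -> cyclic G -> powerful p G.
Proof.
move=> p_pr pG cG; rewrite /powerful pG /=.
have -> : [~: G, G] = 1 by apply/commG1P; apply: cyclic_abelian.
by rewrite !sub1G !andbT; case: (even_prime p_pr) => [->|->]; rewrite ?orbT.
Qed.

Lemma cyclic_subgroups_powerful_cover p G :
  prime p -> p.-group G -> ~~ cyclic G ->
  powerful_cover p G (cyclic_subgroups G).
Proof.
move=> p_pr pG ncG; apply/andP; split; [apply/andP; split|].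
- apply/forall_inP => _ /imsetP[x Gx ->].
  rewrite properEneq cycle_subG Gx andbT.
  by apply: contraNneq ncG => <-; apply: cycle_cyclic.
- rewrite eqEsubset; apply/andP; split.
    by apply/bigcupsP => _ /imsetP[x Gx ->]; rewrite cycle_subG.
  apply/subsetP => x Gx; apply/bigcupP; exists <[x]>%G; last exact: cycle_id.
  exact: imset_f.
apply/forall_inP => _ /imsetP[x Gx ->].
apply: cyclic_powerful => //; last exact: cycle_cyclic.
by apply: pgroupS pG; rewrite cycle_subG.
Qed.

Lemma powerful_covering_numberP p G :
  prime p -> p.-group G -> ~~ cyclic G ->
  (exists2 C, powerful_cover p G C & #|C| = powerful_covering_number p G) /\
  (forall C, powerful_cover p G C -> powerful_covering_number p G <= #|C|).
Proof.
move=> p_pr pG ncG; rewrite /powerful_covering_number.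
case: arg_minnP => [|C PC minC]; first exact: cyclic_subgroups_powerful_cover.
by split=> //; exists C.
Qed.

End PowerfulCovers.

(* Main.v *)
Require Import Defs.
From mathcomp Require Import all_boot all_fingroup all_solvable.

Local Open Scope group_scope.

(** Covers pull back along surjective homomorphisms: preimages of proper
    subgroups are proper, by surjectivity, and preimages commute with unions
    ([group_cover_morphpre]). Hence the preimages of the members of a minimal
    powerful cover of [K], which are powerful by hypothesis, form a powerful
    cover of [G]. Taking preimages cannot increase the number of members, so
    this cover has at most as many members as the covering number of [K]. *)

Lemma group_cover_morphpre (gT kT : finGroupType) (G : {group gT})
    (alpha : {morphism G >-> kT}) (C : {set {group kT}}) :
  group_cover (alpha @* G) C ->
  group_cover G [set (alpha @*^-1 H)%G | H : {group kT} in C].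
Proof.
case/andP=> /forall_inP properC /eqP coverC; apply/andP; split.
  apply/forall_inP=> _ /imsetP[H CH ->].
  rewrite properE subsetIl /= -sub_morphim_pre //.
  by have := properC H CH; rewrite properE => /andP[].
rewrite eqEsubset; apply/andP; split; apply/subsetP=> x.
  by case/bigcupP=> _ /imsetP[H _ ->] /morphpreP[].
move=> Gx; have: alpha x \in alpha @* G by apply: mem_morphim.
rewrite -coverC => /bigcupP[H CH Hx].
by apply/bigcupP; exists (alpha @*^-1 H)%G; [apply: imset_f | apply/morphpreP].
Qed.

Theorem theorem3p5 (p : nat) (gT kT : finGroupType)
    (G : {group gT}) (K : {group kT})
    (p_prime : prime p)
    (pG : p.-group G) (ncG : ~~ cyclic G)
    (pK : p.-group K) (ncK : ~~ cyclic K)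
    (q : nat) (H : 'I_q -> {group kT})
    (H_cover : powerful_cover p K [set H i | i : 'I_q])
    (H_min : q = powerful_covering_number p K)
    (lift : exists2 alpha : {morphism G >-> kT},
              alpha @* G = K
              & forall i : 'I_q, powerful p (alpha @*^-1 (H i))) :
  powerful_covering_number p G <= powerful_covering_number p K.
Proof.
case: lift => alpha imG powH.
have /andP[coverH _] := H_cover.
have [_ minG] := @powerful_covering_numberP gT p G p_prime pG ncG.
pose C := [set (alpha @*^-1 L)%G | L : {group kT} in [set H i | i : 'I_q]].
have powC : powerful_cover p G C.
  apply/andP; split.
    (* [imG] equates sets, while covers are stated for groups. *)
    have imGG : (alpha @* G)%G = K by apply: val_inj.
    by apply: group_cover_morphpre; rewrite imGG.
  by apply/forall_inP=> _ /imsetP[_ /imsetP[i _ ->] ->]; apply: powH.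
apply: leq_trans (minG C powC) _.
rewrite -H_min -[leqRHS]card_ord.
exact: leq_trans (leq_imset_card _ _) (leq_imset_card _ _).
Qed.
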